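(* Define, for $n\ge1$: (1) $\delta_n$, the $\mathcal C$-linear derivation of $\mathfrak H$ with $\delta_n(\mathbf a)=0$, $\delta_n(\mathbf b)=\frac{(-1)^{n-1}}{n}(\mathbf b+1)\mathbf a^n\mathbf b$, and $\Phi_X=\exp\big(\sum_{n\ge1}X^n\delta_n\big):\mathfrak H\to\mathfrak H[[X]]$; (2) $d_n$, the $\mathcal C[[X]]$-linear derivation of $\mathfrak H[[X]]$ given by $d_n(w)=\frac{(-\hbar)^{n-1}}{n}\{(\mathbf a\mathbf b^n)\sqcup\!\sqcup_q w-\mathbf a\mathbf b^n w\}$, and $\Psi_X=\exp\big(\sum_{n\ge1}X^nd_n\big):\mathfrak H[[X]]\to\mathfrak H[[X]]$; (3) $\partial_n$, the $\mathcal C$-linear derivation of $\mathfrak H$ with \[ \partial_n(\mathbf a)=\frac{(-1)^n}{n}\mathbf a\{\mathbf a(\mathbf b+1)+\hbar\mathbf b\}^{n-1}(\mathbf a+\hbar)\mathbf b,\qquad \partial_n(\mathbf b)=\frac{(-1)^{n-1}}{n}\mathbf a\{(\mathbf b+1)\mathbf a+\hbar\mathbf b\}^{n-1}(\mathbf b+1)\mathbf b, \] and $\Delta_X=\exp\big(\sum_{n\ge1}X^n\partial_n\big):\mathfrak H\to\mathfrak H[[X]]$. Then $\Phi_X=\Psi_X\circ\Delta_X$ on $\mathfrak H$.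
   Context: Let $\hbar$ be a formal variable, $\mathcal{C}=\mathbb{Q}[\hbar,\hbar^{-1}]$, and $\mathfrak{H}=\mathcal{C}\langle \mathbf{a},\mathbf{b}\rangle$ the non-commutative polynomial ring over $\mathcal{C}$. The shuffle product $\sqcup\!\sqcup_q$ is the $\mathcal{C}$-bilinear product on $\mathfrak H$ with $1\sqcup\!\sqcup_q w=w\sqcup\!\sqcup_q 1=w$, $(\mathbf a w)\sqcup\!\sqcup_q(\mathbf a w')=\mathbf a\big((\mathbf a w)\sqcup\!\sqcup_q w'+w\sqcup\!\sqcup_q(\mathbf a w')+\hbar\, w\sqcup\!\sqcup_q w'\big)$, $(\mathbf b w)\sqcup\!\sqcup_q w'=w\sqcup\!\sqcup_q(\mathbf b w')=\mathbf b(w\sqcup\!\sqcup_q w')$, extended $\mathcal C[[X]]$-linearly to $\mathfrak H[[X]]$, $X$ a commuting formal variable. Derivations of $\mathfrak H$ are extended $\mathcal C[[X]]$-linearly to $\mathfrak H[[X]]$, and for $D=\sum_{n\ge1}X^nD_n$ one sets $\exp(D)=\sum_{s\ge0}D^s/s!$ (well defined since $D$ raises the $X$-order); these exponentials are algebra homomorphisms. *)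

(* Defs.v *)
From HB Require Import structures.
From mathcomp Require Import all_boot all_order all_algebra.
From mathcomp Require Import finmap.
From mathcomp Require Import boolp.
From mathcomp.multinomials Require Import monalg.

Set Implicit Arguments.
Unset Strict Implicit.
Unset Printing Implicit Defensive.

Import GRing.Theory.
Local Open Scope ring_scope.

(* Q[hbar, 1/hbar], as the subring of the fraction field of Q[hbar] whose     *)
(* elements have a power of hbar as a denominator.                            *)
Definition is_laurent : {pred {fraction {poly rat}}} := fun x =>
  `[< exists (p : {poly rat}) (n : nat), x = tofrac p / tofrac 'X ^+ n >].

Lemma is_laurentP x : reflect
  (exists (p : {poly rat}) (n : nat), x = tofrac p / tofrac 'X ^+ n)
  (x \in is_laurent).
Proof. exact: asboolP. Qed.

Lemma tofracX_neq0 : tofrac 'X != 0 :> {fraction {poly rat}}.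
Proof. by rewrite tofrac_eq0 polyX_eq0. Qed.

Fact is_laurent_subring : subring_closed is_laurent.
Proof.
have X0 n : tofrac 'X ^+ n != 0 :> {fraction {poly rat}}.
  exact: expf_neq0 tofracX_neq0.
split=> [|x y /is_laurentP[p [n ->]] /is_laurentP[q [m ->]]
         |x y /is_laurentP[p [n ->]] /is_laurentP[q [m ->]]]; apply/is_laurentP.
- by exists 1, 0%N; rewrite expr0 divr1 tofrac1.
- exists (p * 'X^m - q * 'X^n), (n + m)%N.
  rewrite -mulNr addf_div ?X0 // tofracB !tofracM !tofracXn mulNr.
  by rewrite exprD.
- by exists (p * q), (n + m)%N; rewrite mulf_div exprD tofracM.
Qed.

HB.instance Definition _ :=
  GRing.isSubringClosed.Build {fraction {poly rat}} is_laurent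
    is_laurent_subring.

Record laurent := Laurent {
  laurent_val : {fraction {poly rat}};
  _ : laurent_val \in is_laurent
}.

HB.instance Definition _ := [isSub for laurent_val].
HB.instance Definition _ := [Choice of laurent by <:].
HB.instance Definition _ := [SubChoice_isSubComNzRing of laurent by <:].

(* The units are the nonzero elements whose inverse is a Laurent polynomial;  *)
(* following the convention of unitRingType, x^-1 = x when x is not a unit.   *)
Definition laurent_unit : pred laurent := fun x =>
  (x != 0) && ((laurent_val x)^-1 \in is_laurent).

Definition laurent_inv (x : laurent) : laurent := insubd x (laurent_val x)^-1.

Fact laurent_val1 : laurent_val 1 = 1.
Proof. exact: (rmorph1 (val : laurent -> _)). Qed.

Fact laurent_valM (x y : laurent) :
  laurent_val (x * y) = laurent_val x * laurent_val y.
Proof. exact: (rmorphM (val : laurent -> _)). Qed.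

Fact laurent_val_eq0 (x : laurent) : (laurent_val x == 0) = (x == 0).
Proof. exact: (inj_eq val_inj x 0). Qed.

Fact laurent_mulVr : {in laurent_unit, left_inverse 1 laurent_inv *%R}.
Proof.
move=> x /andP[x_neq0 Vx]; apply: (@val_inj _ _ laurent).
have -> : \val (laurent_inv x * x) = laurent_val (laurent_inv x) * laurent_val x.
  exact: laurent_valM.
have -> : laurent_val (laurent_inv x) = (laurent_val x)^-1.
  exact: (insubdK x Vx).
by rewrite mulVf ?laurent_val_eq0 //; exact: esym laurent_val1.
Qed.

Fact laurent_unitPl (x y : laurent) : y * x = 1 -> laurent_unit x.
Proof.
move=> yx1; have x_neq0 : x != 0.
  by apply: contra_eq_neq yx1 => ->; rewrite mulr0 eq_sym oner_neq0.
have vx_neq0 : laurent_val x != 0 by rewrite laurent_val_eq0.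
apply/andP; split=> //.
have -> : (laurent_val x)^-1 = laurent_val y.
  apply: (mulIf vx_neq0); rewrite mulVf //.
  by rewrite -laurent_valM yx1 laurent_val1.
exact: valP y.
Qed.

Fact laurent_inv_out : {in [predC laurent_unit], laurent_inv =1 id}.
Proof.
move=> x /negP nUx; apply: (@val_inj _ _ laurent).
rewrite /laurent_inv val_insubd; case: ifP => // Vx.
have [x0|x_neq0] := eqVneq (laurent_val x) 0.
  apply: (etrans (congr1 GRing.inv x0)); rewrite invr0; exact: esym x0.
by case: nUx; apply/andP; rewrite -laurent_val_eq0.
Qed.

HB.instance Definition _ := GRing.ComNzRing_hasMulInverse.Build laurent
  laurent_mulVr laurent_unitPl laurent_inv_out.

Fact poly_laurent_subproof (p : {poly rat}) : tofrac p \in is_laurent.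
Proof. by apply/is_laurentP; exists p, 0%N; rewrite expr0 divr1. Qed.

Definition poly_laurent (p : {poly rat}) : laurent :=
  Laurent (poly_laurent_subproof p).

Definition hbar : laurent := poly_laurent 'X.

Lemma hbar_unit : hbar \is a GRing.unit.
Proof.
apply/andP; split; first by rewrite -(inj_eq val_inj) tofracX_neq0.
by apply/is_laurentP; exists 1, 1%N; rewrite tofrac1 div1r expr1.
Qed.

Lemma laurent_natr_unit (n : nat) : (0 < n)%N ->
  (n%:R : laurent) \is a GRing.unit.
Proof.
move=> n_gt0; apply/unitrPr; exists (poly_laurent (n%:R^-1)%:P).
apply: (@val_inj _ _ laurent); apply: (etrans (laurent_valM _ _)).
rewrite [laurent_val _%:R](rmorph_nat (val : laurent -> _)).
rewrite -tofrac1 -(rmorph_nat (@tofrac _)) -tofracM -polyC_natr -polyCM mulfV //.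
by rewrite Num.Theory.pnatr_eq0 -lt0n.
Qed.

(* The letter a is true and the letter b is false. *)
Notation letter := bool.
Notation word := (fmonom letter).

(* C<a, b>, as the algebra over C of the free monoid on {a, b}. *)
Notation freealg C := {malg C[word]}.

Section Operators.

Variables (C : comUnitRingType) (h : C).

Local Notation Hfr := (freealg C).

Definition wd (s : seq letter) : Hfr := << FMonom s >>.
Definition aH : Hfr := wd [:: true].
Definition bH : Hfr := wd [:: false].

Definition linext (f : word -> Hfr) (w : Hfr) : Hfr :=
  \sum_(k <- msupp w) w@_k *: f k.

(* The derivation with a |-> da and b |-> db (see der_is_derivation). *)
Fixpoint der_word (da db : Hfr) (s : seq letter) : Hfr :=
  if s is x :: s' then
    (if x then da else db) * wd s' + wd [:: x] * der_word da db s'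
  else 0.

Definition der (da db : Hfr) : Hfr -> Hfr := linext (der_word da db).

(* The shuffle product (see sh1w, shw1, sh_aa, sh_bl, sh_br). *)
Fixpoint sh_word (s : seq letter) {struct s} : seq letter -> Hfr :=
  match s with
  | [::] => wd
  | false :: s' => fun t => bH * sh_word s' t
  | true :: s' =>
      fix sh_word_as' (t : seq letter) : Hfr :=
        match t with
        | [::] => wd s
        | false :: t' => bH * sh_word_as' t'
        | true :: t' =>
            aH * (sh_word_as' t' + sh_word s' t + h *: sh_word s' t')
        end
  end.

Definition sh (u v : Hfr) : Hfr :=
  linext (fun k => linext (fun l => sh_word k l) v) u.

(* Hfr[[X]], with f m the coefficient of X^m.  A linear map on Hfr acts on it *)
(* coefficientwise.                                                           *)
Definition series := nat -> Hfr.

Definition cst (w : Hfr) : series := fun m => if m is 0 then w else 0.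

(* The operator D = \sum_(n >= 1) X^n D_n on Hfr[[X]]. *)
Definition Xsum (D : nat -> Hfr -> Hfr) (f : series) : series :=
  fun m => \sum_(1 <= n < m.+1) D n (f (m - n)%N).

(* exp D = \sum_(s >= 0) D^s / s!.  The terms with s > m do not contribute to *)
(* the coefficient of X^m (see iter_Xsum_order).                              *)
Definition expX (D : nat -> Hfr -> Hfr) (f : series) : series :=
  fun m => \sum_(0 <= s < m.+1)
    (s`!%:R^-1 : C) *: iter s (Xsum D) f m.

Definition delta (n : nat) : Hfr -> Hfr :=
  der 0 (((-1) ^+ n.-1 / n%:R : C) *: ((bH + 1) * aH ^+ n * bH)).

(* The C-linear derivation of Hfr (see dd_is_derivation) whose                *)
(* C[[X]]-linear extension to Hfr[[X]] is d_n.                                *)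
Definition dd (n : nat) (w : Hfr) : Hfr :=
  ((- h) ^+ n.-1 / n%:R) *:
    (sh (aH * bH ^+ n) w - aH * bH ^+ n * w).

Definition partial (n : nat) : Hfr -> Hfr :=
  der
    (((-1) ^+ n / n%:R : C) *:
       (aH * (aH * (bH + 1) + h *: bH) ^+ n.-1 * (aH + h *: 1) * bH))
    (((-1) ^+ n.-1 / n%:R : C) *:
       (aH * ((bH + 1) * aH + h *: bH) ^+ n.-1 * (bH + 1) * bH)).

Definition Phi (w : Hfr) : series := expX delta (cst w).
Definition Psi (f : series) : series := expX dd f.
Definition Delta (w : Hfr) : series := expX partial (cst w).

Lemma iter_Xsum_order (D : nat -> Hfr -> Hfr) (f : series) (s m : nat) :
  (forall n, D n 0 = 0) -> (m < s)%N -> iter s (Xsum D) f m = 0.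
Proof.
move=> D0; elim: s m => [//|s IHs] m lt_ms /=.
rewrite /Xsum big_nat_cond big1 // => n /andP[/andP[n_gt0 le_nm] _].
rewrite IHs ?D0 // -ltnS (leq_trans _ lt_ms) // ltnS.
by rewrite ltn_subrL n_gt0 (leq_trans n_gt0).
Qed.

Lemma linextEw (f : word -> Hfr) (E : {fset word}) (w : Hfr) :
  (msupp w `<=` E)%fset -> linext f w = \sum_(k <- E) w@_k *: f k.
Proof.
move=> le; rewrite /linext; apply: big_fset_incl => // k _ /mcoeff_outdom ->.
by rewrite scale0r.
Qed.

Definition linop (f : Hfr -> Hfr) : Prop :=
  forall (c : C) (u v : Hfr), f (c *: u + v) = c *: f u + f v.

Lemma linextP (f : word -> Hfr) : linop (linext f).
Proof.
move=> c u v; pose E := (msupp u `|` msupp v `|` msupp (c *: u + v))%fset.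
have lu : (msupp u `<=` E)%fset by rewrite /E -fsetUA fsubsetUl.
have lv : (msupp v `<=` E)%fset by rewrite /E fsetUAC fsubsetUr.
have luv : (msupp (c *: u + v) `<=` E)%fset by rewrite /E fsubsetUr.
rewrite (linextEw f lu) (linextEw f lv) (linextEw f luv).
rewrite scaler_sumr -big_split /=; apply: eq_bigr => k _.
by rewrite mcoeffD mcoeffZ scalerDl scalerA.
Qed.

Lemma linext_wd f s : linext f (wd s) = f (FMonom s).
Proof. by rewrite /linext msuppU1 big_seq_fset1 mcoeffUU scale1r. Qed.

Lemma wd_cat s t : wd (s ++ t) = wd s * wd t.
Proof.
rewrite /wd malgM_def fgmulUU mulr1; congr << _ >>.
by apply: val_inj; rewrite /= fmM.
Qed.

Lemma wd_nil : wd [::] = 1.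
Proof.
by rewrite /wd; congr << _ >>; apply: val_inj; rewrite /= fm1.
Qed.

Lemma wd_cons x s : wd (x :: s) = wd [:: x] * wd s.
Proof. by rewrite -wd_cat. Qed.

Lemma Hfr_scalerAr (c : C) (u v : Hfr) : c *: (u * v) = u * (c *: v).
Proof.
apply/malgP=> k; have E1 := mcoeffMl u v k.
have E2 := mcoeffMlw k (fsubset_refl (msupp u)) (msuppZ_le c v).
rewrite mcoeffZ; apply: (etrans (congr1 ( *%R c) E1)); apply: etrans (esym E2).
rewrite mulr_sumr; apply: eq_bigr => l _; rewrite mulr_sumr.
by apply: eq_bigr => j _; rewrite mcoeffZ mulrnAr mulrCA.
Qed.

Lemma Hfr_ind (P : Hfr -> Prop) :
  (forall s, P (wd s)) -> (forall c u v, P u -> P v -> P (c *: u + v)) ->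
  forall w, P w.
Proof.
move=> Pw PD w; have P0 : P 0.
  by rewrite -(addNr (wd [::])) -scaleN1r; apply: PD.
rewrite [w]monalgE; elim: (enum_fset _) => [|k s IHs]; first by rewrite big_nil.
rewrite big_cons; have -> : << w@_k *g k >> = w@_k *: wd k :> Hfr.
  by apply/malgP=> l; rewrite mcoeffZ !mcoeffU fmK mulrnAr mulr1.
exact: PD.
Qed.

Lemma linop_eq (f g : Hfr -> Hfr) :
  linop f -> linop g -> (forall s, f (wd s) = g (wd s)) -> f =1 g.
Proof.
move=> lf lg fg; apply: Hfr_ind => // c u v fgu fgv.
by rewrite lf lg fgu fgv.
Qed.

Lemma linop_comp (f g : Hfr -> Hfr) : linop f -> linop g -> linop (f \o g).
Proof. by move=> lf lg c u v; rewrite /= lg lf. Qed.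

Lemma linop_add (f g : Hfr -> Hfr) :
  linop f -> linop g -> linop (fun w => f w + g w).
Proof. by move=> lf lg c u v; rewrite lf lg scalerDr addrACA. Qed.

Lemma linop_opp (f : Hfr -> Hfr) : linop f -> linop (fun w => - f w).
Proof. by move=> lf c u v; rewrite lf opprD scalerN. Qed.

Lemma linop_scale (k : C) : linop ( *:%R k).
Proof. by move=> c u v; rewrite scalerDr !scalerA mulrC. Qed.

Lemma linop_mul (x : Hfr) : linop ( *%R x).
Proof. by move=> c u v; rewrite mulrDr -Hfr_scalerAr. Qed.

Definition derivation (D : Hfr -> Hfr) : Prop :=
  linop D /\ (forall u v : Hfr, D (u * v) = D u * v + u * D v).

(* Stated over an abstract algebra to keep unification fast. *)
Lemma leibniz_ext (A : lalgType C) (W : seq letter -> A) (D : A -> A) :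
  (forall P : A -> Prop, (forall s, P (W s)) ->
     (forall c u v, P u -> P v -> P (c *: u + v)) -> forall w, P w) ->
  (forall c (u v : A), c *: (u * v) = u * (c *: v)) ->
  W [::] = 1 -> (forall s t, W (s ++ t) = W s * W t) ->
  (forall c u v, D (c *: u + v) = c *: D u + D v) ->
  D 1 = 0 ->
  (forall x s, D (W [:: x] * W s) = D (W [:: x]) * W s + W [:: x] * D (W s)) ->
  forall u v, D (u * v) = D u * v + u * D v.
Proof.
move=> indA scalerAr W0 Wcat Dlin D1 DW u v.
elim/indA: u => [s|c u1 u2 IH1 IH2]; last first.
  rewrite mulrDl -scalerAl !Dlin IH1 IH2.
  by rewrite !mulrDl -!scalerAl scalerDr addrACA.
elim/indA: v => [t|c v1 v2 IH1 IH2]; last first.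
  rewrite mulrDr -scalerAr !Dlin IH1 IH2.
  by rewrite !mulrDr -!scalerAr scalerDr addrACA.
elim: s => [|x s IHs]; first by rewrite W0 !mul1r D1 mul0r add0r.
have Wcons : W (x :: s) = W [:: x] * W s by rewrite -Wcat.
rewrite Wcons -mulrA -Wcat DW Wcat IHs DW.
by rewrite mulrDr mulrDl !mulrA addrA.
Qed.

Lemma derivation_ext (D : Hfr -> Hfr) :
  linop D ->
  D 1 = 0 ->
  (forall x s, D (wd [:: x] * wd s) = D (wd [:: x]) * wd s
                                       + wd [:: x] * D (wd s)) ->
  derivation D.
Proof.
move=> Dlin D1 Dwd; split=> // u v.
exact: (leibniz_ext Hfr_ind Hfr_scalerAr wd_nil wd_cat).
Qed.

Lemma der_a da db : der da db aH = da.
Proof. by rewrite /der linext_wd /= wd_nil mulr1 mulr0 addr0. Qed.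

Lemma der_b da db : der da db bH = db.
Proof. by rewrite /der linext_wd /= wd_nil mulr1 mulr0 addr0. Qed.

Lemma der_is_derivation da db : derivation (der da db).
Proof.
apply: derivation_ext => [c u v||x s]; first exact: linextP.
  by rewrite -wd_nil /der linext_wd.
rewrite -wd_cons /der !linext_wd /=.
by rewrite wd_nil mulr1 mulr0 addr0.
Qed.

Lemma sh_linl w' : linop (sh^~ w').
Proof. exact: linextP. Qed.

Lemma scaler_sum_split (V : lmodType C) (I : Type) (r : seq I) (c : C)
    (k : I -> C) (f g : I -> V) :
  \sum_(i <- r) k i *: (c *: f i + g i) =
  c *: (\sum_(i <- r) k i *: f i) + \sum_(i <- r) k i *: g i.
Proof.
rewrite scaler_sumr -big_split; apply: eq_bigr => i _.
by rewrite scalerDr !scalerA mulrC.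
Qed.

Lemma sh_linr w : linop (sh w).
Proof.
move=> c u v; rewrite -[RHS]scaler_sum_split; apply: eq_bigr => k _.
by rewrite linextP.
Qed.

Lemma sh_wd s t : sh (wd s) (wd t) = sh_word s t.
Proof. by rewrite /sh !linext_wd. Qed.

Lemma sh_word_bl s t : sh_word (false :: s) t = bH * sh_word s t.
Proof. reflexivity. Qed.

Lemma sh_word_ab s t :
  sh_word (true :: s) (false :: t) = bH * sh_word (true :: s) t.
Proof. reflexivity. Qed.

Lemma sh_word_aa s t :
  sh_word (true :: s) (true :: t) =
  aH * (sh_word (true :: s) t + sh_word s (true :: t) + h *: sh_word s t).
Proof. reflexivity. Qed.

Lemma sh_word1 s : sh_word s [::] = wd s.
Proof.
elim: s => [|[] s IHs]; [reflexivity | reflexivity |].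
rewrite (sh_word_bl s [::]) IHs (wd_cons false s); reflexivity.
Qed.

Lemma sh_word_br s t : sh_word s (false :: t) = bH * sh_word s t.
Proof.
elim: s => [|[] s IHs]; [exact (wd_cons false t) | exact (sh_word_ab s t) |].
rewrite (sh_word_bl s (false :: t)) IHs (sh_word_bl s t); reflexivity.
Qed.

Lemma sh1w w : sh 1 w = w.
Proof.
apply: (linop_eq (sh_linr 1) (g := id)) => // s.
by rewrite -wd_nil sh_wd.
Qed.

Lemma shw1 w : sh w 1 = w.
Proof.
apply: (linop_eq (sh_linl 1) (g := id)) => // s.
by rewrite -wd_nil sh_wd sh_word1.
Qed.

Lemma sh_bl w w' : sh (bH * w) w' = bH * sh w w'.
Proof.
apply: (linop_eq (linop_comp (sh_linl w') (linop_mul bH))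
                 (linop_comp (linop_mul bH) (sh_linl w'))) => s /=.
apply: (linop_eq (sh_linr (bH * wd s))
                 (linop_comp (linop_mul bH) (sh_linr (wd s)))) => t /=.
by rewrite -(wd_cons false s) !sh_wd.
Qed.

Lemma sh_br w w' : sh w (bH * w') = bH * sh w w'.
Proof.
apply: (linop_eq (linop_comp (sh_linr w) (linop_mul bH))
                 (linop_comp (linop_mul bH) (sh_linr w))) => t /=.
apply: (linop_eq (sh_linl (bH * wd t))
                 (linop_comp (linop_mul bH) (sh_linl (wd t)))) => s /=.
by rewrite -(wd_cons false t) !sh_wd sh_word_br.
Qed.

Lemma sh_aa w w' :
  sh (aH * w) (aH * w') =
  aH * (sh (aH * w) w' + sh w (aH * w') + h *: sh w w').
Proof.
apply: (linop_eq (linop_comp (sh_linl (aH * w')) (linop_mul aH))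
  (linop_comp (linop_mul aH) (linop_add
    (linop_add (linop_comp (sh_linl w') (linop_mul aH)) (sh_linl (aH * w')))
    (linop_comp (linop_scale h) (sh_linl w'))))) => s /=.
apply: (linop_eq (linop_comp (sh_linr (aH * wd s)) (linop_mul aH))
  (linop_comp (linop_mul aH) (linop_add
    (linop_add (sh_linr (aH * wd s)) (linop_comp (sh_linr (wd s)) (linop_mul aH)))
    (linop_comp (linop_scale h) (sh_linr (wd s)))))) => t /=.
by rewrite -(wd_cons true s) -(wd_cons true t) !sh_wd.
Qed.

Lemma sh_bX n w : sh (bH ^+ n) w = bH ^+ n * w.
Proof.
elim: n => [|n IHn]; first by rewrite expr0 sh1w mul1r.
by rewrite exprS sh_bl IHn; exact: mulrA.
Qed.

Lemma leibniz_dd_b (A : lalgType C) (b z w s : A) :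
  b * s - z * (b * w) = (b * z - z * b) * w + b * (s - z * w).
Proof. by rewrite mulrBl mulrBr !mulrA [RHS]addrC addrA subrK. Qed.

Lemma leibniz_dd_a (A : lalgType C) (a y z w s : A) :
  a * (s + y * (a * w) + h *: (y * w)) - z * (a * w) =
  (a * (z + y * a + h *: y) - z * a) * w + a * (s - z * w).
Proof.
set x := y * a + h *: y; rewrite -(addrA z) -/x.
have -> : s + y * (a * w) + h *: (y * w) = s + x * w.
  by rewrite mulrDl mulrA scalerAl addrA.
clearbody x; rewrite !mulrBl !mulrDr !mulrDl mulrN !mulrA.
by rewrite -(addrA (a * z * w)) [RHS]addrC [RHS]addrA subrK addrA.
Qed.

Lemma dd_is_derivation n : derivation (dd n).
Proof.
rewrite /dd; set z := aH * bH ^+ n; set k := _ / _.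
apply: derivation_ext => [||x s].
- apply: (linop_comp (linop_scale k)).
  exact: linop_add (sh_linr z) (linop_opp (linop_mul z)).
- by rewrite shw1 mulr1 subrr scaler0.
rewrite -scalerAl -Hfr_scalerAr -scalerDr; congr (_ *: _).
case: x; rewrite -/aH -/bH; set w := wd s; last first.
  have E : sh z bH = bH * z by have := sh_br z 1; rewrite mulr1 shw1.
  rewrite sh_br E; exact: leibniz_dd_b.
have E v : sh z (aH * v) =
    aH * (sh z v + bH ^+ n * (aH * v) + h *: (bH ^+ n * v)).
  by rewrite /z sh_aa !sh_bX.
have E1 : sh z aH = aH * (z + bH ^+ n * aH + h *: bH ^+ n).
  by have := E 1; rewrite shw1 !mulr1.
rewrite E E1; exact: leibniz_dd_a.
Qed.

End Operators.

(* Main.v *)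
(* Put u = a + h, v = b + 1, J = 1 - Xab, M = 1 + hXb and N = 1 + Xub.  For a
   derivation D and series l, r, the operator w |-> D w + l w + w r obeys a
   Leibniz rule whose two factors are operators of the same kind, so that its
   exponential is multiplicative in the corresponding sense.  If such an
   operator R satisfies R^k(1) = x F (cF)^(k-1) y with F = log(1 + cX) / c,
   then exp(R)(1) = 1 + x X y; with c one of a, hb, va + hb this evaluates
   all the exponentials needed, and yields Phi(a) = a, Phi(v) J = v, Psi(u) J
   = u, Psi(v) J = J v, Delta(u) N = u M, and Delta(v) = g v where g M = N.
   Hence Psi(N) J = M, Psi(M) J = J M and Psi(g) J = 1, so that Psi(Delta(u))
   = u and Psi(Delta(v)) J = v = Phi(v) J. *)

Require Import Defs.
From HB Require Import structures.
From mathcomp Require Import all_boot all_order all_algebra.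
From mathcomp Require Import finmap boolp.
From mathcomp.multinomials Require Import monalg.

Set Implicit Arguments.
Unset Strict Implicit.
Unset Printing Implicit Defensive.

Import GRing.Theory.
Local Open Scope ring_scope.

(** * Formal power series *)

Definition ps (A : nzRingType) : Type := nat -> A.

Section PowerSeries.

Variable A : nzRingType.

Implicit Types f g k : ps A.

HB.instance Definition _ := gen_eqMixin (ps A).
HB.instance Definition _ := gen_choiceMixin (ps A).

Lemma psP f g : (forall m, f m = g m) -> f = g.
Proof. exact: functional_extensionality_dep. Qed.

Definition ps_zero : ps A := fun=> 0.
Definition ps_opp f : ps A := fun m => - f m.
Definition ps_add f g : ps A := fun m => f m + g m.

Fact ps_addA : associative ps_add.
Proof. by move=> f g k; apply: psP => m; exact: addrA. Qed.
Fact ps_addC : commutative ps_add.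
Proof. by move=> f g; apply: psP => m; exact: addrC. Qed.
Fact ps_add0 : left_id ps_zero ps_add.
Proof. by move=> f; apply: psP => m; exact: add0r. Qed.
Fact ps_addN : left_inverse ps_zero ps_opp ps_add.
Proof. by move=> f; apply: psP => m; exact: addNr. Qed.

HB.instance Definition _ :=
  GRing.isZmodule.Build (ps A) ps_addA ps_addC ps_add0 ps_addN.

Definition cst_ps (x : A) : ps A := fun m => if m is 0 then x else 0.

Definition ps_mul f g : ps A := fun m => \sum_(i < m.+1) f i * g (m - i)%N.

Definition trunc n f : {poly A} := \poly_(i < n) f i.

Lemma coef_trunc n f i : (i < n)%N -> (trunc n f)`_i = f i.
Proof. by move=> lt_in; rewrite coef_poly lt_in. Qed.

(** The coefficient of X^m involves only coefficients of index at most m, so it can be computed on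
    polynomial truncations. Associativity and the Leibniz rule for series are then inherited from
    [{poly A}]. *)
Lemma ps_mul_trunc n f g m :
  (m < n)%N -> ps_mul f g m = (trunc n f * trunc n g)`_m.
Proof.
move=> lt_mn; rewrite coefM; apply: eq_bigr => i _.
rewrite !coef_trunc //; first exact: leq_ltn_trans (leq_subr _ _) lt_mn.
by apply: leq_trans (ltn_ord i) _.
Qed.

Fact ps_mulA : associative ps_mul.
Proof.
move=> f g k; apply: psP => m; pose t := trunc m.+1.
have tM x y i : (i <= m)%N -> (t (ps_mul x y))`_i = (t x * t y)`_i.
  by move=> le_im; rewrite coef_trunc // -ps_mul_trunc.
rewrite !(@ps_mul_trunc m.+1) //; transitivity ((t f * t g * t k)`_m).
  rewrite -mulrA [LHS]coefM [RHS]coefM; apply: eq_bigr => i _.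
  by congr (_ * _); apply: tM; exact: leq_subr.
rewrite [LHS]coefM [RHS]coefM; apply: eq_bigr => i _.
by congr (_ * _); rewrite tM // -ltnS.
Qed.

Fact ps_mul1 : left_id (cst_ps 1) ps_mul.
Proof.
move=> f; apply: psP => m; rewrite /ps_mul big_ord_recl /= mul1r subn0.
by rewrite big1 ?addr0 // => i _; rewrite mul0r.
Qed.

Fact ps_mulr1 : right_id (cst_ps 1) ps_mul.
Proof.
move=> f; apply: psP => m; rewrite /ps_mul big_ord_recr /= subnn /= mulr1.
rewrite big1 ?add0r // => i _; rewrite /cst_ps.
by rewrite -(subnSK (ltn_ord i)) mulr0.
Qed.

Fact ps_mulDl : left_distributive ps_mul +%R.
Proof.
move=> f g k; apply: psP => m; rewrite /ps_mul.
rewrite -[RHS]big_split; apply: eq_bigr => i _; exact: mulrDl.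
Qed.

Fact ps_mulDr : right_distributive ps_mul +%R.
Proof.
move=> f g k; apply: psP => m; rewrite /ps_mul.
rewrite -[RHS]big_split; apply: eq_bigr => i _; exact: mulrDr.
Qed.

Fact ps_oner_neq0 : cst_ps 1 != 0 :> ps A.
Proof. by apply/eqP => /(congr1 (@^~ 0%N)) /= /eqP; rewrite oner_eq0. Qed.

HB.instance Definition _ := GRing.Zmodule_isNzRing.Build (ps A)
  ps_mulA ps_mul1 ps_mulr1 ps_mulDl ps_mulDr ps_oner_neq0.

Lemma ps0E m : (0 : ps A) m = 0. Proof. by []. Qed.
Lemma ps1E m : (1 : ps A) m = (m == 0%N)%:R. Proof. by case: m. Qed.
Lemma psDE f g m : (f + g) m = f m + g m. Proof. by []. Qed.
Lemma psNE f m : (- f) m = - f m. Proof. by []. Qed.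
Lemma psME f g m : (f * g) m = \sum_(i < m.+1) f i * g (m - i)%N.
Proof. by []. Qed.

Lemma psMnE f n m : (f *+ n) m = f m *+ n.
Proof. by elim: n => // n IHn; rewrite !mulrS psDE IHn. Qed.

Lemma ps_sumE (I : Type) (r : seq I) (P : pred I) (F : I -> ps A) m :
  (\sum_(i <- r | P i) F i) m = \sum_(i <- r | P i) F i m.
Proof. by elim/big_rec2: _ => // i y z _ <-. Qed.

Lemma cst_psMl x f m : (cst_ps x * f) m = x * f m.
Proof.
rewrite psME big_ord_recl /= subn0 big1 ?addr0 // => i _.
by rewrite mul0r.
Qed.

Lemma cst_psMr f x m : (f * cst_ps x) m = f m * x.
Proof.
rewrite psME big_ord_recr /= subnn /= big1 ?add0r // => i _.
by rewrite /cst_ps -(subnSK (ltn_ord i)) mulr0.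
Qed.

Fact cst_ps_zmod_morphism : zmod_morphism cst_ps.
Proof. by move=> x y; apply: psP => -[|m] //; rewrite psDE psNE /= subr0. Qed.

Fact cst_ps_monoid_morphism : monoid_morphism cst_ps.
Proof.
split=> // x y; apply: psP => m; rewrite cst_psMl.
by case: m => //= m; rewrite mulr0.
Qed.

HB.instance Definition _ :=
  GRing.isZmodMorphism.Build A (ps A) cst_ps cst_ps_zmod_morphism.
HB.instance Definition _ :=
  GRing.isMonoidMorphism.Build A (ps A) cst_ps cst_ps_monoid_morphism.

Definition psX : ps A := fun m => (m == 1%N)%:R.

Lemma psXM f m : (psX * f) m = if m is m'.+1 then f m' else 0.
Proof.
rewrite psME; case: m => [|m].
  by rewrite big_ord_recl big_ord0 /psX /= mul0r addr0.
rewrite big_ord_recl big_ord_recl /psX /= mul0r add0r mul1r subSS subn0.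
by rewrite big1 ?addr0 // => i _; rewrite mul0r.
Qed.

Lemma psMX f m : (f * psX) m = if m is m'.+1 then f m' else 0.
Proof.
rewrite psME; case: m => [|m].
  by rewrite big_ord_recl big_ord0 /psX /= mulr0 addr0.
rewrite big_ord_recr big_ord_recr /psX /= subnn /= mulr0 addr0.
rewrite subSn // subnn mulr1 big1 ?add0r // => i _.
by rewrite subSn 1?ltnW // -(subnSK (ltn_ord i)) mulr0.
Qed.

Lemma psXC f : psX * f = f * psX.
Proof. by apply: psP => m; rewrite psXM psMX. Qed.

(** Stands in for inverting g: in (f - k) g the coefficient of X^m is that of f - k plus products
    that vanish by induction on m. *)
Lemma ps_mulI_unipotent g f k : g 0%N = 1 -> f * g = k * g -> f = k.
Proof.
move=> g0 /eqP; rewrite -subr_eq0 -mulrBl => /eqP fkg0; apply/eqP.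
rewrite -subr_eq0; move: (f - k) fkg0 => {f k} f fg0; apply/eqP/psP => m.
elim/ltn_ind: m => m IHm; have := congr1 (@^~ m) fg0.
rewrite psME big_ord_recr /= subnn g0 mulr1 big1 ?add0r // => i _.
by rewrite IHm ?mul0r.
Qed.

Definition ps_deriv f : ps A := fun m => f m.+1 *+ m.+1.

Lemma ps_derivD f g : ps_deriv (f + g) = ps_deriv f + ps_deriv g.
Proof. by apply: psP => m; exact: mulrnDl. Qed.

Lemma ps_derivM f g : ps_deriv (f * g) = ps_deriv f * g + f * ps_deriv g.
Proof.
have dt n x i : (i < n)%N -> (trunc n.+1 x)^`()`_i = ps_deriv x i.
  by move=> lt_in; rewrite coef_deriv coef_trunc.
apply: psP => m; have lt_m : (m < m.+1)%N by [].
rewrite psDE /ps_deriv [(f * g) _](@ps_mul_trunc m.+2) //.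
rewrite -coef_deriv derivM coefD.
congr (_ + _); rewrite coefM; apply: eq_bigr => i _.
  rewrite dt // coef_trunc //; first by rewrite ltnS (leq_trans (leq_subr _ _)).
rewrite dt ?ltnS ?leq_subr // coef_trunc //.
exact: ltn_trans (ltn_ord i) _.
Qed.

End PowerSeries.

Arguments psX {A}.

(** * Scalar action on power series *)

Section ScalarSeries.

Variables (C : comUnitRingType) (A : algType C).

Definition ps_scale (c : C) (f : ps A) : ps A := fun m => c *: f m.

Fact ps_scalerA c d f : ps_scale c (ps_scale d f) = ps_scale (c * d) f.
Proof. by apply: psP => m; exact: scalerA. Qed.
Fact ps_scale1r : left_id 1 ps_scale.
Proof. by move=> f; apply: psP => m; exact: scale1r. Qed.
Fact ps_scalerDr : right_distributive ps_scale +%R.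
Proof. by move=> c f g; apply: psP => m; exact: scalerDr. Qed.
Fact ps_scalerDl f : {morph ps_scale^~ f : c d / c + d}.
Proof. by move=> c d; apply: psP => m; exact: scalerDl. Qed.

HB.instance Definition _ := GRing.Zmodule_isLmodule.Build C (ps A)
  ps_scalerA ps_scale1r ps_scalerDr ps_scalerDl.

Lemma psZE c (f : ps A) m : (c *: f) m = c *: f m. Proof. by []. Qed.

Fact ps_scalerAl c (f g : ps A) : c *: (f * g) = (c *: f) * g.
Proof.
apply: psP => m; rewrite psZE !psME scaler_sumr; apply: eq_bigr => i _.
exact: scalerAl.
Qed.

HB.instance Definition _ := GRing.Lmodule_isLalgebra.Build C (ps A) ps_scalerAl.

Fact ps_scalerAr c (f g : ps A) : c *: (f * g) = f * (c *: g).
Proof.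
apply: psP => m; rewrite psZE !psME scaler_sumr; apply: eq_bigr => i _.
exact: scalerAr.
Qed.

HB.instance Definition _ := GRing.Lalgebra_isAlgebra.Build C (ps A) ps_scalerAr.

Lemma ps_derivZ c (f : ps A) : ps_deriv (c *: f) = c *: ps_deriv f.
Proof. by apply: psP => m; rewrite psZE /ps_deriv psZE scalerMnr. Qed.

Lemma cst_ps_lin c (x y : A) : cst_ps (c *: x + y) = c *: cst_ps x + cst_ps y.
Proof. by apply: psP => -[|m] //; rewrite psDE psZE /= scaler0 addr0. Qed.

End ScalarSeries.

(** * Reindexing of triangular double sums *)

Lemma sum_triangle (V : zmodType) (F : nat -> nat -> V) m :
  \sum_(i < m.+1) \sum_(j < (m - i).+1) F i j =
  \sum_(k < m.+1) \sum_(i < k.+1) F i (k - i)%N.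
Proof.
elim: m => [|m IHm]; first by rewrite !big_ord1.
rewrite [RHS]big_ord_recr -IHm big_ord_recr /= subnn big_ord1.
rewrite [\sum_(i < m.+2) _]big_ord_recr /= subnn addrA; congr (_ + _).
rewrite -big_split; apply: eq_bigr => i _ /=.
by rewrite subSn -1?ltnS // big_ord_recr.
Qed.

Lemma sum_triangleC (V : zmodType) (F : nat -> nat -> V) m :
  \sum_(i < m.+1) \sum_(j < (m - i).+1) F i j =
  \sum_(j < m.+1) \sum_(i < (m - j).+1) F i j.
Proof.
rewrite sum_triangle (sum_triangle (fun j i => F i j)); apply: eq_bigr => k _.
rewrite (reindex_inj rev_ord_inj); apply: eq_bigr => i _ /=.
by rewrite subSS subKn // -ltnS.
Qed.

(** * Evaluation at t = 1 *)

Section EvalAt1.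

Variable A : nzRingType.

Implicit Types g k : ps (ps A).

(* For power series in t over ps A: convergence at t = 1. *)
Definition summable g := forall s m, (m < s)%N -> g s m = 0.

Definition ev1 g : ps A := fun m => \sum_(s < m.+1) g s m.

Lemma ev1_widen g n m : summable g -> (m < n)%N ->
  ev1 g m = \sum_(s < n) g s m.
Proof.
move=> sg lt_mn; rewrite /ev1 (big_ord_widen n (g^~ m)) //.
rewrite big_mkcond; apply: eq_bigr => s _ /=.
by case: ltnP => // lt_ms; rewrite sg.
Qed.

(** The X-order of [g i * k j] is at least i + j, so at X^m the sum over i + j <= m can be completed
    to the square i, j <= m. *)
Lemma ev1M g k : summable g -> summable k -> ev1 (g * k) = ev1 g * ev1 k.
Proof.
move=> sg sk; apply: psP => m.
have gk0 i j : (m < i + j)%N -> (g i * k j) m = 0.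
  move=> lt_m; rewrite psME big1 // => l _.
  have [lt_li|le_il] := ltnP l i; first by rewrite sg ?mul0r.
  rewrite sk ?mulr0 // ltn_subLR -1?ltnS //.
  by apply: leq_trans lt_m _; rewrite leq_add2r.
transitivity (((\sum_(i < m.+1) g i) * (\sum_(j < m.+1) k j)) m).
  rewrite /ev1; under eq_bigr => s _ do rewrite psME ps_sumE.
  rewrite -(sum_triangle (fun i j => (g i * k j) m)) mulr_suml ps_sumE.
  apply: eq_bigr => i _; rewrite mulr_sumr ps_sumE.
  rewrite (big_ord_widen m.+1 (fun j => (g i * k j) m)) ?ltnS ?leq_subr //.
  rewrite big_mkcond; apply: eq_bigr => j _; rewrite ltnS.
  by case: leqP => //; rewrite ltn_subLR -1?ltnS // => /gk0.
rewrite !psME; apply: eq_bigr => l _; rewrite !ps_sumE.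
rewrite (ev1_widen sg (ltn_ord l)).
by rewrite (ev1_widen (n := m.+1) sk) ?ltnS ?leq_subr.
Qed.

End EvalAt1.

(** * Exponentials of families of operators *)

Section OperatorExp.

Variables (C : comUnitRingType) (A : algType C).

Implicit Types (D R T P : nat -> A -> A) (f g : ps A).

Definition linfam D :=
  forall n c (x y : A), D n (c *: x + y) = c *: D n x + D n y.

(** Three families rather than one: a twisted operator acts on the two factors of a product through
    differently twisted operators. *)
Definition leibniz T R P :=
  forall n (x y : A), T n (x * y) = R n x * y + x * P n y.

Definition opX D f : ps A := fun m => \sum_(1 <= n < m.+1) D n (f (m - n)%N).

Lemma linfam0 D n : linfam D -> D n 0 = 0.
Proof.
by move=> lD; have := lD n (-1) 0 0; rewrite scaler0 addr0 scaleN1r addNr.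
Qed.

Lemma linfamD D n x y : linfam D -> D n (x + y) = D n x + D n y.
Proof. by move=> lD; rewrite -[x]scale1r lD !scale1r. Qed.

Lemma linfamZ D n c x : linfam D -> D n (c *: x) = c *: D n x.
Proof. by move=> lD; rewrite -[c *: x]addr0 lD linfam0 // addr0. Qed.

Lemma linfam_sum D n (I : Type) (r : seq I) (F : I -> A) : linfam D ->
  D n (\sum_(i <- r) F i) = \sum_(i <- r) D n (F i).
Proof.
move=> lD; elim/big_rec2: _ => [|i x y _ <-]; first exact: linfam0.
exact: linfamD.
Qed.

Lemma opX_lin D c f g : linfam D -> opX D (c *: f + g) = c *: opX D f + opX D g.
Proof.
move=> lD; apply: psP => m; rewrite psDE psZE scaler_sumr -big_split /=.
by apply: eq_bigr => n _; exact: lD.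
Qed.

Lemma opX0 D : linfam D -> opX D 0 = 0.
Proof. by move=> lD; apply: psP => m; apply: big1 => n _; exact: linfam0. Qed.

Lemma opXD D f g : linfam D -> opX D (f + g) = opX D f + opX D g.
Proof. by move=> lD; rewrite -[f]scale1r opX_lin // !scale1r. Qed.

Lemma opXZ D c f : linfam D -> opX D (c *: f) = c *: opX D f.
Proof. by move=> lD; rewrite -[c *: f]addr0 opX_lin // opX0 // addr0. Qed.

Lemma opX_sum D (I : Type) (r : seq I) (F : I -> ps A) : linfam D ->
  opX D (\sum_(i <- r) F i) = \sum_(i <- r) opX D (F i).
Proof.
move=> lD; elim/big_rec2: _ => [|i x y _ <-]; first exact: opX0.
exact: opXD.
Qed.

Lemma opXE D f m :
  opX D f m =
  \sum_(n < m.+1) (if n == 0%N :> nat then 0 else D n (f (m - n)%N)).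
Proof.
rewrite /opX big_ord_recl add0r big_add1 /= big_mkord.
by apply: eq_bigr => i _.
Qed.

(** [opX] starts at n = 1, hence the condition on the constant term of g. *)
Lemma opX_cst D x (g : ps A) :
  g 0%N = 0 -> (forall n, D n x = g n) -> linfam D -> opX D (cst_ps x) = g.
Proof.
move=> g0 Dg lD; apply: psP => -[|m]; first by rewrite g0 /opX big_nil.
rewrite opXE big_ord_recr /= subnn Dg big1 ?add0r // => n _.
by rewrite /cst_ps subSn -1?ltnS // linfam0 ?if_same.
Qed.

Lemma opX_leibniz T R P f g : linfam T -> leibniz T R P ->
  opX T (f * g) = opX R f * g + f * opX P g.
Proof.
move=> lT TRP; apply: psP => m; rewrite psDE opXE.
(* Extending both families by zero at n = 0 makes all sums start at 0, as the triangular reindexing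
   requires. *)
pose R0 n x := if n == 0%N then 0 else R n x.
pose P0 n x := if n == 0%N then 0 else P n x.
transitivity (\sum_(n < m.+1) \sum_(i < (m - n).+1)
    (R0 n (f i) * g (m - n - i)%N + f i * P0 n (g (m - n - i)%N))).
  apply: eq_bigr => n _; rewrite /R0 /P0; case: eqP => _.
    by rewrite big1 // => i _; rewrite mul0r mulr0 addr0.
  by rewrite linfam_sum //; apply: eq_bigr => i _.
under eq_bigr do rewrite big_split /=.
rewrite big_split /=; congr (_ + _); rewrite psME.
  rewrite (sum_triangle (fun n i => R0 n (f i) * g (m - n - i)%N)).
  apply: eq_bigr => k _; rewrite opXE mulr_suml; apply: eq_bigr => n _.
  by rewrite -subnDA subnKC -1?ltnS.
rewrite (sum_triangleC (fun n i => f i * P0 n (g (m - n - i)%N))).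
apply: eq_bigr => i _; rewrite opXE mulr_sumr; apply: eq_bigr => n _.
by rewrite subnAC.
Qed.

Lemma iter_opX_order D f s m : linfam D -> (m < s)%N -> iter s (opX D) f m = 0.
Proof.
move=> lD; elim: s m => [//|s IHs] m lt_ms /=.
rewrite /opX big_nat_cond big1 // => n /andP[/andP[n_gt0 le_nm] _].
rewrite IHs ?linfam0 // -ltnS (leq_trans _ lt_ms) // ltnS.
by rewrite ltn_subrL n_gt0 (leq_trans n_gt0).
Qed.

(* exp(tD) f as a power series in t *)
Definition expt D f : ps (ps A) := fun s => (s`!%:R^-1 : C) *: iter s (opX D) f.

Definition opexp D f : ps A := fun m =>
  \sum_(0 <= s < m.+1) (s`!%:R^-1 : C) *: iter s (opX D) f m.

Lemma expt_summable D f : linfam D -> summable (expt D f).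
Proof. by move=> lD s m ms; rewrite /expt psZE iter_opX_order ?scaler0. Qed.

Lemma opexp_ev1 D f : opexp D f = ev1 (expt D f).
Proof. by apply: psP => m; rewrite /opexp big_mkord. Qed.

Lemma iter_opX_lin D c f g s : linfam D ->
  iter s (opX D) (c *: f + g) = c *: iter s (opX D) f + iter s (opX D) g.
Proof. by move=> lD; elim: s => //= s ->; exact: opX_lin. Qed.

Lemma opexp_lin D c f g : linfam D ->
  opexp D (c *: f + g) = c *: opexp D f + opexp D g.
Proof.
move=> lD; apply: psP => m; rewrite psDE psZE scaler_sumr -big_split /=.
apply: eq_bigr => s _; rewrite iter_opX_lin // psDE psZE scalerDr.
by rewrite !scalerA mulrC.
Qed.

Lemma opexpD D f g : linfam D -> opexp D (f + g) = opexp D f + opexp D g.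
Proof. by move=> lD; rewrite -[f]scale1r opexp_lin // !scale1r. Qed.

Lemma opexp_ker D f : linfam D -> opX D f = 0 -> opexp D f = f.
Proof.
move=> lD Df0; apply: psP => m; rewrite /opexp big_nat_recl //.
rewrite big1 ?addr0 ?fact0 ?invr1 ?scale1r // => s _.
have -> : iter s.+1 (opX D) f = 0.
  by elim: s => //= s ->; exact: opX0.
by rewrite scaler0.
Qed.

Lemma opX_intertwine D R (u : A) f :
  (forall n x, D n (u * x) = u * R n x) ->
  opX D (cst_ps u * f) = cst_ps u * opX R f.
Proof.
move=> DR; apply: psP => m; rewrite cst_psMl /opX mulr_sumr.
by apply: eq_bigr => n _; rewrite cst_psMl DR.
Qed.

Lemma opexp_intertwine D R (u : A) f :
  (forall n x, D n (u * x) = u * R n x) ->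
  opexp D (cst_ps u * f) = cst_ps u * opexp R f.
Proof.
move=> DR.
apply: psP => m; rewrite cst_psMl /opexp mulr_sumr; apply: eq_bigr => s _.
have -> : iter s (opX D) (cst_ps u * f) = cst_ps u * iter s (opX R) f.
  by elim: s => //= s ->; exact: opX_intertwine.
by rewrite cst_psMl scalerAr.
Qed.

Hypothesis natU : forall n, (n.+1%:R : C) \is a GRing.unit.

Lemma fact_unit n : (n`!%:R : C) \is a GRing.unit.
Proof. by rewrite -(prednK (fact_gt0 n)). Qed.

Lemma natmulI n (x y : A) : x *+ n.+1 = y *+ n.+1 -> x = y.
Proof.
move=> exy; rewrite -[x]scale1r -[y]scale1r -(mulVr (natU n)) -!scalerA.
by rewrite !scaler_nat exy.
Qed.

Lemma fact_recV n : (n.+1`!%:R^-1 : C) *+ n.+1 = n`!%:R^-1.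
Proof.
rewrite -[LHS]mulr_natr factS natrM invrM ?fact_unit // -mulrA mulVr //.
exact: mulr1.
Qed.

Lemma deriv_expt D f s : linfam D ->
  ps_deriv (expt D f) s = opX D (expt D f s).
Proof.
move=> lD; rewrite /ps_deriv /expt opXZ // -scaler_nat scalerA.
by rewrite mulr_natl fact_recV.
Qed.

(** exp(tD) f is the only solution of dg/dt = D g with value f at t = 0: the equation determines (s
    + 1) g_(s+1) from g_s, and s + 1 is invertible. *)
Lemma expt_unique D f (g : ps (ps A)) : linfam D -> g 0%N = f ->
  (forall s, ps_deriv g s = opX D (g s)) -> g = expt D f.
Proof.
move=> lD g0 gS; apply: psP; elim=> [|s IHs].
  by rewrite g0 /expt fact0 invr1 scale1r.
have /esym := deriv_expt f s lD; rewrite -IHs -gS => e.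
apply: psP => m; have := congr1 (@^~ m) e; rewrite /ps_deriv !psMnE.
exact: natmulI.
Qed.

(** By the Leibniz rule in t, the product on the right solves the differential equation that
    characterizes exp(tT)(fg). *)
Lemma expt_leibniz T R P f g : linfam T -> linfam R -> linfam P ->
  leibniz T R P -> expt T (f * g) = expt R f * expt P g.
Proof.
move=> lT lR lP TRP; apply/esym/expt_unique => // [|s].
  by rewrite psME big_ord1 /expt fact0 invr1 !scale1r.
rewrite ps_derivM psDE !psME -big_split opX_sum //; apply: eq_bigr => i _ /=.
by rewrite !deriv_expt // (opX_leibniz _ _ lT TRP).
Qed.

Lemma opexp_leibniz T R P f g : linfam T -> linfam R -> linfam P ->
  leibniz T R P -> opexp T (f * g) = opexp R f * opexp P g.
Proof.
move=> lT lR lP TRP; rewrite !opexp_ev1 (expt_leibniz _ _ lT lR lP) //.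
by apply: ev1M; exact: expt_summable.
Qed.

Lemma leibniz1 D n : leibniz D D D -> D n 1 = 0.
Proof.
move=> dD; apply: (addIr (D n 1)); rewrite add0r.
by have := dD n 1 1; rewrite !mul1r mulr1 => {3}->.
Qed.

(** The series log(1 + cX) / c, expanded so that c need not be invertible. *)
Definition log_ps (c : A) : ps A :=
  fun m => if m is n.+1 then ((-1) ^+ n / n.+1%:R : C) *: c ^+ n else 0.

(** * The logarithm and its exponential *)

Section Log.

Variable c : A.

Local Notation F := (log_ps c).
Local Notation kc := (cst_ps c).

Lemma log_ps_comm : kc * F = F * kc.
Proof.
apply: psP => m; rewrite cst_psMl cst_psMr; case: m => [|m] /=.
  by rewrite mulr0 mul0r.
by rewrite -scalerAl -scalerAr -exprS -exprSr.
Qed.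

Lemma deriv_log_psE m : ps_deriv F m = (-1) ^+ m *: c ^+ m.
Proof.
rewrite /ps_deriv /= -scaler_nat scalerA mulrC -mulrA mulVr //.
by rewrite mulr1.
Qed.

Lemma deriv_log_ps : ps_deriv F * (1 + kc * psX) = 1.
Proof.
apply: psP => m; rewrite mulrDr mulr1 mulrA psDE psMX deriv_log_psE.
case: m => [|m]; first by rewrite !expr0 scale1r addr0.
rewrite cst_psMr deriv_log_psE -scalerAl -exprSr exprS mulN1r scaleNr.
by rewrite addNr.
Qed.

(** F' is the inverse of 1 + cX, so it commutes with whatever commutes with c. *)
Lemma deriv_log_comm (g : ps A) : kc * g = g * kc ->
  ps_deriv F * g = g * ps_deriv F.
Proof.
move=> cg; have cg1 : g * (1 + kc * psX) = (1 + kc * psX) * g.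
  by rewrite mulrDr mulrDl mulr1 mul1r -[in RHS]mulrA psXC !mulrA cg.
have u0 : (1 + kc * psX : ps A) 0%N = 1 by rewrite psDE psMX addr0.
apply: (ps_mulI_unipotent u0).
by rewrite -!mulrA cg1 deriv_log_ps mulr1 mulrA deriv_log_ps mul1r.
Qed.

Lemma deriv_log_pow k :
  ps_deriv (F * (kc * F) ^+ k) = ((kc * F) ^+ k * ps_deriv F) *+ k.+1.
Proof.
have dk : ps_deriv kc = 0 by apply: psP => m; exact: mul0rn.
have cF : kc * (kc * F) = kc * F * kc by rewrite -mulrA log_ps_comm.
have dF : ps_deriv F * kc = kc * ps_deriv F by exact: deriv_log_comm.
have dkF : ps_deriv F * (kc * F) = kc * F * ps_deriv F.
  exact: deriv_log_comm cF.
elim: k => [|k IHk]; first by rewrite !expr0 mulr1 mul1r.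
rewrite exprSr mulrA ps_derivM IHk ps_derivM dk mul0r add0r.
rewrite mulrnAl -mulrA dkF mulrA -exprSr [RHS]mulrSr; congr (_ + _).
rewrite mulrA exprSr; congr (_ * _).
have FX : GRing.comm F ((kc * F) ^+ k).
  by apply: commrX; rewrite /GRing.comm mulrA -log_ps_comm.
by rewrite FX -mulrA log_ps_comm.
Qed.

(** A truncated form of (exp(cF) - 1) / c = X. The partial sums satisfy W_(n+1)' (1 + cX) = 1 + c
    W_n, which is also the equation of X, so each further term secures one more coefficient. *)
Lemma exp_log_ps N m : (m <= N)%N ->
  (\sum_(k < N) (k.+1`!%:R^-1 : C) *: (F * (kc * F) ^+ k)) m = psX m.
Proof.
pose W n : ps A := \sum_(k < n) (k.+1`!%:R^-1 : C) *: (F * (kc * F) ^+ k).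
rewrite -/(W N).
have W0 n : W n 0%N = 0.
  rewrite /W ps_sumE big1 // => k _; rewrite psZE psME big_ord1 /=.
  by rewrite mul0r scaler0.
have dW n : ps_deriv (W n.+1) * (1 + kc * psX) = 1 + kc * W n.
  suff -> : ps_deriv (W n.+1) = (1 + kc * W n) * ps_deriv F.
    by rewrite -mulrA deriv_log_ps mulr1.
  rewrite /W (big_morph _ (@ps_derivD A) (_ : _ = 0)); last first.
    by apply: psP => j; exact: mul0rn.
  have dk k : ps_deriv ((k.+1`!%:R^-1 : C) *: (F * (kc * F) ^+ k)) =
      (k`!%:R^-1 : C) *: ((kc * F) ^+ k * ps_deriv F).
    rewrite ps_derivZ deriv_log_pow -scaler_nat scalerA mulr_natr.
    by rewrite fact_recV.
  rewrite big_ord_recl dk fact0 invr1 scale1r expr0 mulrDl.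
  congr (_ + _); rewrite mulr_sumr mulr_suml; apply: eq_bigr => k _.
  by rewrite dk -scalerAr -scalerAl mulrA -exprS.
(* The coefficient of X^m in this equation gives coefficient m + 1 of W_(N+1) from W_N (outer
   induction) and from coefficient m of W_(N+1) (inner induction). *)
elim: N m => [|N IHN] m; first by rewrite leqn0 => /eqP->; rewrite W0.
elim: m => [|m IHm] le_m; first by rewrite W0.
have := congr1 (@^~ m) (dW N); rewrite mulrDr mulr1 mulrA !psDE psMX cst_psMl.
rewrite IHN // /ps_deriv => eW; apply: natmulI (m) _ _ _.
move: eW; case: m IHm le_m => [|m] IHm le_m.
  by rewrite addr0 mulr0 addr0 => ->.
rewrite cst_psMr IHm 1?ltnW // ps1E add0r.
case: m {IHm le_m} => [|m]; rewrite /psX /=.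
  by rewrite mul1r mulr1 mul0rn -[RHS]add0r => /addIr.
by rewrite mul0rn mul0r addr0 mulr0 mul0rn.
Qed.

(** By the hypotheses D^(s+1) f = x F (cF)^s y, so the exponential series sums to f + x ((exp(cF) -
    1) / c) y. *)
Lemma opexp_log D f (x y : A) :
  opX D f = cst_ps x * F * cst_ps y ->
  (forall k, opX D (cst_ps x * (F * (kc * F) ^+ k) * cst_ps y) =
             cst_ps x * (F * (kc * F) ^+ k.+1) * cst_ps y) ->
  opexp D f = f + cst_ps x * psX * cst_ps y.
Proof.
move=> D1 DS; have it s :
    iter s.+1 (opX D) f = cst_ps x * (F * (kc * F) ^+ s) * cst_ps y.
  by elim: s => [|s IHs]; [rewrite mulr1 | rewrite iterS IHs DS].
apply: psP => m; rewrite psDE cst_psMr cst_psMl -(exp_log_ps (leqnn m)).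
rewrite /opexp big_nat_recl // fact0 invr1 scale1r; congr (_ + _).
rewrite big_mkord ps_sumE mulr_sumr mulr_suml; apply: eq_bigr => s _.
by rewrite it cst_psMr cst_psMl psZE -scalerAr -scalerAl.
Qed.

(** The coefficients are scalar combinations of powers of c, which a derivation vanishing at c
    kills. *)
Lemma opX_log_ker D k : linfam D -> leibniz D D D -> (forall n, D n c = 0) ->
  opX D (F * (kc * F) ^+ k) = 0.
Proof.
move=> lD dD Dc0; have Dk : opX D kc = 0.
  exact: opX_cst lD.
have DF : opX D F = 0.
  apply: psP => m; rewrite /opX big1 // => n _.
  case: (m - n)%N => [|j]; first exact: linfam0.
  rewrite /= linfamZ //; suff -> : D n (c ^+ j) = 0 by rewrite scaler0.
  elim: j => [|j IHj]; first exact: leibniz1.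
  by rewrite exprS dD IHj Dc0 mul0r mulr0 addr0.
have DM f g : opX D f = 0 -> opX D g = 0 -> opX D (f * g) = 0.
  by move=> f0 g0; rewrite (opX_leibniz _ _ lD dD) f0 g0 mul0r mulr0 addr0.
apply: (DM) => //; elim: k => [|k IHk].
  rewrite expr0 -(rmorph1 (@cst_ps A)); apply: opX_cst => // n.
  exact: leibniz1.
by rewrite exprS; apply: (DM) => //; apply: (DM).
Qed.

End Log.

(** * Derivations twisted by left and right multiplications *)

Definition twist D (l r : ps A) : nat -> A -> A :=
  fun n x => D n x + l n * x + x * r n.

Lemma twist_lin D l r : linfam D -> linfam (twist D l r).
Proof.
move=> lD n c x y; rewrite /twist lD mulrDr mulrDl !scalerDr.
rewrite -scalerAr -scalerAl.
by rewrite [X in X + _ = _]addrACA [LHS]addrACA.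
Qed.

Lemma twist0 D : twist D 0 0 = D.
Proof.
apply: functional_extensionality_dep => n.
apply: functional_extensionality_dep => x.
by rewrite /twist ps0E mul0r mulr0 !addr0.
Qed.

(** The right twist t on x and the left twist -t on y contribute x t y and its opposite, so t may be
    chosen freely. *)
Lemma twist_leibniz D l r t : leibniz D D D ->
  leibniz (twist D l r) (twist D l t) (twist D (- t) r).
Proof.
move=> dD n x y; rewrite /twist dD psNE.
rewrite mulNr !mulrDr mulrN !mulrDl !mulrA [RHS]addrA; congr (_ + _).
by rewrite (addrC (x * D n y)) addrA addrK addrAC.
Qed.

Lemma opX_twist D l r t f g : linfam D -> leibniz D D D ->
  opX (twist D l r) (f * g) =
  opX (twist D l t) f * g + f * opX (twist D (- t) r) g.
Proof.
by move=> lD dD; apply: opX_leibniz; [exact: twist_lin | exact: twist_leibniz].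
Qed.

Lemma opexp_twist D l r t f g : linfam D -> leibniz D D D ->
  opexp (twist D l r) (f * g) =
  opexp (twist D l t) f * opexp (twist D (- t) r) g.
Proof.
move=> lD dD; apply: opexp_leibniz; try exact: twist_lin.
exact: twist_leibniz.
Qed.

Lemma opX_leibniz_twist D r f g : linfam D -> leibniz D D D ->
  opX (twist D 0 r) (f * g) = opX D f * g + f * opX (twist D 0 r) g.
Proof. by move=> lD dD; rewrite (opX_twist _ _ 0) // oppr0 twist0. Qed.

Lemma opexp_twist0 D r f g : linfam D -> leibniz D D D ->
  opexp (twist D 0 r) (f * g) = opexp D f * opexp (twist D 0 r) g.
Proof. by move=> lD dD; rewrite (opexp_twist _ _ 0) // oppr0 twist0. Qed.

Lemma opexp_cst1 D : linfam D -> leibniz D D D -> opexp D (cst_ps 1) = 1.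
Proof.
move=> lD dD; apply: opexp_ker => //; apply: opX_cst => // n.
exact: leibniz1.
Qed.

Lemma opX_psX D : linfam D -> leibniz D D D -> opX D psX = 0.
Proof.
move=> lD dD; apply: psP => m; rewrite /opX big1 // => n _; rewrite /psX.
by case: eqP => _; [exact: leibniz1 | exact: linfam0].
Qed.

End OperatorExp.

(** * The three exponentials on generators *)

Section ThreeExponentials.

Variables (C : comUnitRingType) (A : algType C).
Hypothesis natU : forall n, (n.+1%:R : C) \is a GRing.unit.
Variables (h : C) (a b : A).

Local Notation u := (a + h *: 1).
Local Notation v := (b + 1).
Local Notation cst := (@cst_ps A).

Lemma cst_ps_sandwich (x y : A) f m : (cst x * f * cst y) m = x * f m * y.
Proof. by rewrite cst_psMr cst_psMl. Qed.

Definition psJ : ps A := 1 - cst a * psX * cst b.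
Definition psM : ps A := 1 + cst (h *: 1) * psX * cst b.
Definition psN : ps A := 1 + cst u * psX * cst b.

(** The generating series behind the derivations d_n (see [log_b_coef]) and, for [t], behind the
    derivations partial_n (see [partial_coef_a] and [partial_coef_b]). *)
Let s : ps A := cst a * log_ps (h *: b) * cst b.
Let t : ps A := cst a * log_ps (v * a + h *: b) * cst b.

(** * The exponential of the shuffle derivations *)

Section Psi.

Variable D : nat -> A -> A.
Hypotheses (lD : linfam D) (dD : leibniz D D D).
Hypothesis D_a : forall n, D n a = u * s n.
Hypothesis D_b : forall n, D n b = b * s n - s n * b.

Let R := twist D 0 (- s).

Let lR : linfam R. Proof. exact: twist_lin. Qed.

Let D_u n : D n u = u * s n.
Proof. by rewrite linfamD // linfamZ // leibniz1 // scaler0 addr0. Qed.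

Let D_v n : D n v = v * s n - s n * v.
Proof.
rewrite linfamD // leibniz1 // addr0 D_b mulrDl mulrDr mul1r mulr1.
by rewrite opprD addrACA subrr addr0.
Qed.

(** With F = log(1 + hbX) / (hb): R(1) = -s = -a F b, R(-a) = a s - u s = -h s = -a F (hb), and D +
    [s, .] is a derivation killing b. Each application of R thus inserts a factor F (hb) after
    -a. *)
Let opexp_R1 : opexp R 1 = psJ.
Proof.
have -> : psJ = 1 + cst (- a) * psX * cst b by rewrite rmorphN !mulNr.
apply: (opexp_log natU (c := h *: b)).
  rewrite -(rmorph1 cst); apply: opX_cst => // [|n].
    by rewrite cst_ps_sandwich mulr0 mul0r.
  rewrite /R /twist leibniz1 // psNE ps0E mul0r mul1r !add0r.
  by rewrite /s !cst_ps_sandwich !mulNr.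
move=> k; set G := log_ps _ * _.
have lT := @twist_lin _ _ D s (- s) lD.
rewrite -mulrA (opX_twist _ _ (- s)) // opprK.
have dT : leibniz (twist D s (- s)) (twist D s (- s)) (twist D s (- s)).
  by have := twist_leibniz (D := D) s (- s) (- s) dD; rewrite opprK.
have Tb n : twist D s (- s) n b = 0.
  by rewrite /twist psNE D_b mulrN subrK addrN.
rewrite (opX_leibniz _ _ lT dT) opX_log_ker // => [|n]; last first.
  by rewrite linfamZ // Tb scaler0.
rewrite (@opX_cst _ _ (twist D s (- s)) b 0) // mul0r mulr0 addr0 mulr0 addr0.
have -> : opX R (cst (- a)) = cst (- a) * log_ps (h *: b) * cst (h *: b).
  apply: opX_cst => // [|n]; first by rewrite cst_ps_sandwich mulr0 mul0r.
  rewrite /R /twist psNE ps0E mul0r addr0 -scaleN1r linfamZ // D_a.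
  rewrite !scaleN1r mulrNN mulrDl opprD addrAC addNr add0r /s !cst_ps_sandwich.
  by rewrite -scalerAl mul1r !mulNr -scalerAr.
by rewrite /G exprS !mulrA.
Qed.

(** R(u) = u s - u s = 0, so exp(R) fixes u, while splitting u as u 1 gives exp(D)(u) exp(R)(1). *)
Lemma psi_u : opexp D (cst u) * psJ = cst u.
Proof.
rewrite -opexp_R1 -opexp_twist0 // mulr1 opexp_ker //.
apply: opX_cst => // n.
by rewrite /R /twist D_u psNE ps0E mul0r addr0 mulrN subrr.
Qed.

(** Two evaluations of exp(R)(v): splitting v as v 1 gives the left side, and splitting it as 1 v
    gives the right side because D + [s, .] kills v. *)
Lemma psi_v : opexp D (cst v) * psJ = psJ * cst v.
Proof.
rewrite -opexp_R1 -opexp_twist0 // mulr1 -[cst v in LHS]mul1r.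
rewrite (opexp_twist natU _ _ (- s)) // opprK; congr (_ * _).
apply: opexp_ker; first exact: twist_lin.
apply: opX_cst => // [n|]; last exact: twist_lin.
by rewrite /twist D_v psNE mulrN subrK addrN.
Qed.

End Psi.

(** * The exponential of the derivations fixing a *)

Section Phi.

Variable D : nat -> A -> A.
Hypotheses (lD : linfam D) (dD : leibniz D D D).
Hypothesis D_a : forall n, D n a = 0.
Hypothesis D_b : forall n, D n b = v * (a * log_ps a n) * b.

Let l : ps A := cst a * log_ps a * cst b.
Let R := twist D 0 (- l).
Let lR : linfam R. Proof. exact: twist_lin. Qed.

Lemma phi_a : opexp D (cst a) = cst a.
Proof. by apply: opexp_ker => //; exact: opX_cst. Qed.

(** With F = log(1 + aX) / a: D kills a and F, and R(b) = v l - b l = l = a F b, so each application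
    of R inserts a factor a F before b. *)
Let opexp_R1 : opexp R 1 = psJ.
Proof.
have -> : psJ = 1 + cst (- a) * psX * cst b by rewrite rmorphN !mulNr.
apply: (opexp_log natU (c := a)).
  rewrite -(rmorph1 cst); apply: opX_cst => // [|n].
    by rewrite cst_ps_sandwich mulr0 mul0r.
  rewrite /R /twist leibniz1 // psNE ps0E mul0r mul1r !add0r.
  by rewrite /l !cst_ps_sandwich !mulNr.
move=> k; set G := log_ps _ * _.
rewrite opX_leibniz_twist // (opX_leibniz _ _ lD dD) opX_log_ker //.
rewrite (opX_cst (g := 0) _ (x := - a)) // => [|n]; last first.
  by rewrite -scaleN1r linfamZ // D_a scaler0.
rewrite mul0r mulr0 addr0 mul0r add0r.
have -> : opX R (cst b) = cst a * log_ps a * cst b.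
  apply: opX_cst => // [|n]; first by rewrite cst_ps_sandwich mulr0 mul0r.
  rewrite /R /twist psNE ps0E mul0r addr0 D_b /l !cst_ps_sandwich mulrN.
  by rewrite !mulrDl mul1r !mulrA addrAC subrr add0r.
by rewrite /G exprSr !mulrA.
Qed.

Lemma phi_v : opexp D (cst v) * psJ = cst v.
Proof.
rewrite -opexp_R1 -opexp_twist0 // mulr1 opexp_ker //.
apply: opX_cst => // n.
rewrite /R /twist psNE ps0E mul0r addr0 linfamD // leibniz1 // addr0 D_b.
by rewrite mulrN /l cst_ps_sandwich !mulrA subrr.
Qed.

End Phi.

(** * Coefficients of the logarithmic series *)

Lemma log_b_coef n :
  s n = ((- h) ^+ n.-1 / n%:R) *: (a * b ^+ n).
Proof.
rewrite /s cst_ps_sandwich; case: n => [|n] /=.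
  (* At n = 0 the scalar is 0, since 0 is its own inverse by convention; this agrees with the zero
     constant term of the logarithm. *)
  by rewrite mulr0 mul0r invr0 mulr0 scale0r.
rewrite exprZn scalerA -scalerAr -scalerAl -(mulrA a) -exprSr; congr (_ *: _).
by rewrite mulrAC -exprMn mulN1r.
Qed.

Lemma log_q_coef n :
  t n = ((-1) ^+ n.-1 / n%:R) *: (a * (v * a + h *: b) ^+ n.-1 * b).
Proof.
rewrite /t cst_ps_sandwich; case: n => [|n] /=.
  by rewrite mulr0 mul0r invr0 mulr0 scale0r.
by rewrite -scalerAr -scalerAl.
Qed.

(** The relation (av + hb) u = u (va + hb) carries u to the left through the powers, and u commutes
    with a. *)
Lemma partial_coef_a n :
  ((-1) ^+ n / n%:R) *: (a * (a * v + h *: b) ^+ n.-1 * u * b) = - (u * t n).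
Proof.
have qu : (a * v + h *: b) * u = u * (v * a + h *: b).
  have xu x : x * u = x * a + h *: x by rewrite mulrDr -scalerAr mulr1.
  have ux x : u * x = a * x + h *: x by rewrite mulrDl -scalerAl mul1r.
  rewrite xu ux (mulrDl (a * v)) (mulrDr a (v * a)) !(scalerDr h).
  rewrite !mulrA -!addrA; congr (_ + _).
  rewrite !addrA; congr (_ + _).
  rewrite -scalerAl -scalerAr -!scalerDr; congr (_ *: _).
  by rewrite mulrDr mulrDl mulr1 mul1r addrCA.
have pu k : (a * v + h *: b) ^+ k * u = u * (v * a + h *: b) ^+ k.
  elim: k => [|k IHk]; first by rewrite mul1r mulr1.
  by rewrite exprSr -mulrA qu mulrA IHk -mulrA -exprSr.
have au : a * u = u * a.
  by rewrite mulrDl mulrDr -scalerAl -scalerAr mul1r mulr1.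
rewrite log_q_coef -mulrA -(mulrA a) (mulrA _ u) pu !mulrA au.
case: n => [|n] /=; first by rewrite invr0 !mulr0 !scale0r mulr0 oppr0.
by rewrite exprS mulN1r mulNr scaleNr -scalerAr !mulrA.
Qed.

Lemma partial_coef_b n :
  ((-1) ^+ n.-1 / n%:R) *: (a * (v * a + h *: b) ^+ n.-1 * v * b) = t n * v.
Proof.
have vb : v * b = b * v by rewrite mulrDl mulrDr mul1r mulr1.
by rewrite log_q_coef -scalerAl -(mulrA _ v b) vb mulrA.
Qed.

(** For y = b^n the left side is the shuffle product of a y with a, minus their concatenation. *)
Lemma dd_coef_a y :
  a * (a * y + y * a + h *: y) - a * y * a = u * (a * y).
Proof.
rewrite [u * _]mulrDl -scalerAl mul1r !mulrDr -scalerAr !mulrA.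
by rewrite addrAC addrK.
Qed.

Lemma delta_coef_b n :
  ((-1) ^+ n.-1 / n%:R) *: (v * a ^+ n * b) = v * (a * log_ps a n) * b.
Proof.
case: n => [|n] /=; first by rewrite invr0 !mulr0 scale0r mul0r.
by rewrite -!scalerAr -scalerAl -exprS.
Qed.

(** * The exponential of the derivations moving both letters *)

Section Delta.

Variable D : nat -> A -> A.
Hypotheses (lD : linfam D) (dD : leibniz D D D).

Let q : A := v * a + h *: b.
(** Chosen so that t + e = u F b, where F = log(1 + qX) / q. *)
Let e : ps A := cst (h *: 1) * log_ps q * cst b.

Hypothesis D_a : forall n, D n a = - (u * t n).
Hypothesis D_b : forall n, D n b = t n * v.

Let T := twist D (- t) t.
Let R := twist D (- t) (t + e).
Let Z := twist D 0 (t + e).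
Let G := opexp (twist D 0 t) 1.
Let E := opexp (twist D (- t) 0) 1.

Let lT : linfam T. Proof. exact: twist_lin. Qed.
Let lR : linfam R. Proof. exact: twist_lin. Qed.
Let lZ : linfam Z. Proof. exact: twist_lin. Qed.
Let dT : leibniz T T T. Proof. exact: twist_leibniz. Qed.

Let D_u n : D n u = - (u * t n).
Proof. by rewrite linfamD // linfamZ // leibniz1 // scaler0 addr0. Qed.

Let D_v n : D n v = t n * v.
Proof. by rewrite linfamD // leibniz1 // addr0 D_b. Qed.

Let T_b n : T n b = v * t n.
Proof.
rewrite /T /twist D_b psNE mulrDr mulrDl mulr1 mul1r mulNr.
by rewrite [X in X + _ = _]addrAC subrr add0r addrC.
Qed.

Let T_a n : T n a = - (h *: t n) - t n * a.
Proof.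
rewrite /T /twist D_a psNE mulrDl opprD -scalerAl mul1r mulNr.
by rewrite addrC !addrA addrN add0r.
Qed.

(** T(v) a + v T(a) + h T(b) = v t a - v (h t + t a) + h v t. Hence T also kills the logarithm in
    q. *)
Let T_q n : T n q = 0.
Proof.
rewrite linfamD // linfamZ // T_b dT linfamD // leibniz1 // addr0 T_b T_a.
rewrite mulrDr mulrN mulrN mulrA addrCA subrr addr0 -scalerAr.
by rewrite addNr.
Qed.

Let R_b : opX R (cst b) = cst q * log_ps q * cst b.
Proof.
apply: opX_cst => // [|n]; first by rewrite cst_ps_sandwich mulr0 mul0r.
rewrite /R /twist psDE mulrDr addrA -/(twist D (- t) t n b) -/T T_b.
rewrite /t /e !cst_ps_sandwich !mulrA -mulrDl -mulrDl; congr (_ * _ * _).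
by rewrite -scalerAr mulr1.
Qed.

(** Splitting before the last b leaves the derivation T on the left, which kills x and q, and R on
    b, where R(b) = v t + b e = q F b. *)
Let R_log x k : opX T (cst x) = 0 ->
  opX R (cst x * (log_ps q * (cst q * log_ps q) ^+ k) * cst b) =
  cst x * (log_ps q * (cst q * log_ps q) ^+ k.+1) * cst b.
Proof.
move=> Tx0; rewrite (opX_twist _ _ t) // -/T -/R (opX_leibniz _ _ lT dT).
rewrite opX_log_ker // Tx0 mul0r mulr0 addr0 mul0r add0r R_b.
by rewrite exprSr !mulrA.
Qed.

Let opexp_R1 : opexp R 1 = psM.
Proof.
apply: (opexp_log natU (c := q)) => [|k].
  rewrite -(rmorph1 cst); apply: opX_cst => // [|n].
    by rewrite cst_ps_sandwich mulr0 mul0r.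
  rewrite /R /twist leibniz1 // psNE psDE mulr1 mul1r add0r.
  by rewrite addrA addNr add0r.
apply: R_log; apply: opX_cst => // n.
by rewrite linfamZ // leibniz1 // scaler0.
Qed.

(** D(u) = -u t supplies the left twist -t by which R differs from Z. *)
Let Z_u n x : Z n (u * x) = u * R n x.
Proof.
rewrite /Z /R /twist dD D_u psNE ps0E mul0r addr0 !mulrDr.
by rewrite !mulNr mulrN !mulrA (addrC (- _)).
Qed.

Let opexp_Z1 : opexp Z 1 = psN.
Proof.
apply: (opexp_log natU (c := q)) => [|k].
  rewrite -(rmorph1 cst); apply: opX_cst => // [|n].
    by rewrite cst_ps_sandwich mulr0 mul0r.
  rewrite /Z /twist leibniz1 // ps0E psDE mul0r mul1r !add0r.
  by rewrite /t /e !cst_ps_sandwich -!mulrDl.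
rewrite -mulrA -[RHS]mulrA (opX_intertwine _ Z_u); congr (_ * _).
have := R_log (x := 1) k; rewrite rmorph1 !mul1r => -> //.
rewrite -(rmorph1 cst); apply: opX_cst => // n; exact: leibniz1.
Qed.

(** Two evaluations of exp(Z)(u): as exp(D)(u) exp(Z)(1), and as u exp(R)(1) by intertwining. *)
Lemma delta_u : opexp D (cst u) * psN = cst u * psM.
Proof.
rewrite -opexp_Z1 -opexp_R1 -opexp_twist0 // mulr1.
by rewrite -(opexp_intertwine _ Z_u) mulr1.
Qed.

(* The flow of D multiplies v on the left by a factor g solving a Riccati     *)
(* equation; g is the ratio of the exponentials psN and psM of linear         *)
(* operators.                                                                 *)
Lemma delta_v : exists2 g, opexp D (cst v) = g * cst v & g * psM = psN.
Proof.
exists G; last first.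
  (* Splitting exp(Z)(1 1) at t leaves R on the second factor. *)
  by rewrite -opexp_Z1 -opexp_R1 -[in RHS](mulr1 1) (opexp_twist natU _ _ t).
(* [E] is a right inverse of [G]. As w |-> D w - t w kills v, it follows that E exp(D)(v) = v, hence
   exp(D)(v) = G v. *)
have GE : G * E = 1.
  have <- : opexp D (1 * 1) = 1 by rewrite mulr1 -(rmorph1 cst) opexp_cst1.
  by rewrite -[in RHS](twist0 D) (opexp_twist natU _ _ t).
have EDv : E * opexp D (cst v) = cst v.
  transitivity (opexp (twist D (- t) 0) (1 * cst v)).
    by rewrite (opexp_twist natU _ _ 0) // oppr0 twist0.
  rewrite mul1r opexp_ker //; first exact: twist_lin.
  apply: opX_cst => // [n|]; last exact: twist_lin.
  by rewrite /twist D_v psNE ps0E mulr0 addr0 mulNr subrr.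
by rewrite -[in RHS]EDv mulrA GE mul1r.
Qed.

End Delta.

(** * Comparison of the three exponentials *)

Variables dl dd dp : nat -> A -> A.
Hypotheses (l_dl : linfam dl) (der_dl : leibniz dl dl dl).
Hypotheses (l_dd : linfam dd) (der_dd : leibniz dd dd dd).
Hypotheses (l_dp : linfam dp) (der_dp : leibniz dp dp dp).
Hypothesis dl_a : forall n, dl n a = 0.
Hypothesis dl_b : forall n, dl n b = v * (a * log_ps a n) * b.
Hypothesis dd_a : forall n, dd n a = u * s n.
Hypothesis dd_b : forall n, dd n b = b * s n - s n * b.
Hypothesis dp_a : forall n, dp n a = - (u * t n).
Hypothesis dp_b : forall n, dp n b = t n * v.

Definition opexp_comp x := opexp dl (cst x) = opexp dd (opexp dp (cst x)).

Lemma opexpM (D : nat -> A -> A) f g : linfam D -> leibniz D D D ->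
  opexp D (f * g) = opexp D f * opexp D g.
Proof. by move=> lD dD; apply: opexp_leibniz. Qed.

Lemma opexp1 (D : nat -> A -> A) : linfam D -> leibniz D D D -> opexp D 1 = 1.
Proof. by move=> lD dD; rewrite -(rmorph1 cst) opexp_cst1. Qed.

Lemma opexp_psX (D : nat -> A -> A) :
  linfam D -> leibniz D D D -> opexp D psX = psX.
Proof. by move=> lD dD; rewrite opexp_ker ?opX_psX. Qed.

Lemma opexp_scalar (D : nat -> A -> A) c : linfam D -> leibniz D D D ->
  opexp D (cst (c *: 1)) = cst (c *: 1).
Proof.
move=> lD dD; apply: opexp_ker => //; apply: opX_cst => // n.
by rewrite linfamZ // leibniz1 // scaler0.
Qed.

Let psi := opexp dd.

Let psiM f g : psi (f * g) = psi f * psi g. Proof. exact: opexpM. Qed.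
Let psiD f g : psi (f + g) = psi f + psi g. Proof. exact: opexpD. Qed.
Let psi1 : psi 1 = 1. Proof. exact: opexp1. Qed.

Let psi_uJ : psi (cst u) * psJ = cst u.
Proof. exact: (psi_u l_dd der_dd dd_a dd_b). Qed.

Let psi_bJ : psi (cst b) * psJ = psJ * cst b.
Proof.
have := psi_v l_dd der_dd dd_a dd_b; rewrite rmorphD rmorph1 -/psi psiD psi1.
by rewrite (mulrDl _ _ psJ) (mulrDr psJ) mul1r mulr1 => /addIr.
Qed.

Let scalarC c f : cst (c *: 1) * f = f * cst (c *: 1).
Proof.
apply: psP => m; rewrite cst_psMl cst_psMr -scalerAl -scalerAr.
by rewrite mul1r mulr1.
Qed.

Let psi_M_J : psi psM * psJ = psJ * psM.
Proof.
rewrite psiD psi1 !psiM [psi (cst _)]opexp_scalar // [psi psX]opexp_psX //.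
rewrite (mulrDl _ _ psJ) (mulrDr psJ) mul1r mulr1.
rewrite -(mulrA _ (psi _)) psi_bJ.
by rewrite !mulrA -[_ * psX * psJ]mulrA psXC mulrA scalarC.
Qed.

(** Psi(u) X Psi(b) J = Psi(u) J X b = u X b, and J + u X b = M because u - a = h. *)
Let psi_N_J : psi psN * psJ = psM.
Proof.
rewrite psiD psi1 !psiM [psi psX]opexp_psX // (mulrDl _ _ psJ) mul1r.
rewrite -(mulrA _ (psi (cst b))) psi_bJ.
rewrite !mulrA -[_ * psX * psJ]mulrA psXC mulrA psi_uJ.
by rewrite rmorphD !mulrDl addrA subrK.
Qed.

Let psM_0 : psM 0%N = 1.
Proof. by rewrite /psM psDE cst_ps_sandwich mulr0 mul0r addr0. Qed.

Let psJ_0 : psJ 0%N = 1.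
Proof. by rewrite /psJ psDE psNE cst_ps_sandwich mulr0 mul0r subr0. Qed.

Lemma opexp_comp_a : opexp_comp a.
Proof.
rewrite /opexp_comp phi_a //; have psi_u : psi (opexp dp (cst u)) = cst u.
  (* After right multiplication by M: Psi(Delta(u)) Psi(N) J = Psi(u M) J = Psi(u) J M = u M. *)
  apply: (ps_mulI_unipotent psM_0).
  rewrite -[in RHS]psi_uJ -mulrA -psi_M_J mulrA -psiM.
  by rewrite -(delta_u l_dp der_dp dp_a dp_b) psiM -mulrA psi_N_J.
move: psi_u; rewrite rmorphD opexpD // opexp_scalar // psiD.
by rewrite [psi (cst (h *: 1))]opexp_scalar // => /addIr.
Qed.

Lemma opexp_comp_b : opexp_comp b.
Proof.
have [g dp_v gM] := delta_v l_dp der_dp dp_a dp_b.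
have gJ : psi g * psJ = 1.
  (* After right multiplication by M: Psi(g) J M = Psi(g) Psi(M) J = Psi(N) J = M. *)
  apply: (ps_mulI_unipotent psM_0).
  by rewrite mul1r -mulrA -psi_M_J mulrA -psiM gM psi_N_J.
have : opexp dl (cst v) = psi (opexp dp (cst v)).
  apply: (ps_mulI_unipotent psJ_0); rewrite phi_v // dp_v psiM.
  rewrite -mulrA (psi_v l_dd der_dd dd_a dd_b) mulrA.
  by rewrite gJ mul1r.
rewrite /opexp_comp rmorphD rmorph1 !opexpD // psiD !opexp1 // psi1.
exact: addIr.
Qed.

Lemma opexp_comp1 : opexp_comp 1.
Proof. by rewrite /opexp_comp rmorph1 !opexp1. Qed.

Lemma opexp_compM x y : opexp_comp x -> opexp_comp y -> opexp_comp (x * y).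
Proof.
by rewrite /opexp_comp rmorphM => ex ey; rewrite !opexpM // ex ey.
Qed.

Lemma opexp_comp_lin c x y :
  opexp_comp x -> opexp_comp y -> opexp_comp (c *: x + y).
Proof.
by rewrite /opexp_comp cst_ps_lin => ex ey; rewrite !opexp_lin // ex ey.
Qed.

End ThreeExponentials.

(** * The free algebra *)

Section FreeAlgebra.

Variables (C : comUnitRingType) (h : C).
Hypothesis natU : forall n, (n.+1%:R : C) \is a GRing.unit.

(* An alias is needed because the algebra instance of malg requires a         *)
(* commutative monoid.                                                        *)
Definition free_alg : Type := freealg C.

HB.instance Definition _ := GRing.Lalgebra.copy free_alg (freealg C).
HB.instance Definition _ :=
  GRing.Lalgebra_isAlgebra.Build C free_alg (@Hfr_scalerAr C).

Local Notation H := free_alg.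

(** [expX] and [Xsum] unfold to the same terms as [opexp] and [opX], so conversion alone transfers
    the abstract results. *)
Let PhiE (w : H) : Phi w = @opexp C free_alg (@delta C) (@cst_ps H w).
Proof. reflexivity. Qed.

Let Psi_DeltaE (w : H) :
  Psi h (Delta h w) =
  @opexp C free_alg (dd h) (@opexp C free_alg (partial h) (@cst_ps H w)).
Proof. reflexivity. Qed.

Let derivation_linfam (D : nat -> H -> H) :
  (forall n, @derivation C (D n)) -> @linfam C H D.
Proof. by move=> dD n; case: (dD n). Qed.

Let derivation_leibniz (D : nat -> H -> H) :
  (forall n, @derivation C (D n)) -> @leibniz C H D D D.
Proof. by move=> dD n; case: (dD n). Qed.

Let delta_der n : @derivation C (@delta C n).
Proof. exact: der_is_derivation. Qed.

Let partial_der n : @derivation C (partial h n).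
Proof. exact: der_is_derivation. Qed.

Let l_delta := @derivation_linfam (@delta C) delta_der.
Let d_delta := @derivation_leibniz (@delta C) delta_der.
Let l_dd := @derivation_linfam (dd h) (@dd_is_derivation C h).
Let d_dd := @derivation_leibniz (dd h) (@dd_is_derivation C h).
Let l_partial := @derivation_linfam (partial h) partial_der.
Let d_partial := @derivation_leibniz (partial h) partial_der.

Let a : H := aH C.
Let b : H := bH C.

Let delta_a n : @delta C n a = 0 :> H.
Proof. exact: der_a. Qed.

Let delta_b n : @delta C n b = (b + 1) * (a * log_ps a n) * b :> H.
Proof. by rewrite -(delta_coef_b a b n); exact: der_b. Qed.

Let partial_a n : partial h n a =
  - ((a + h *: 1) *
     (cst_ps a * log_ps ((b + 1) * a + h *: b) * cst_ps b : ps H) n) :> H.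
Proof. by rewrite -(partial_coef_a h a b n); exact: der_a. Qed.

Let partial_b n : partial h n b =
  (cst_ps a * log_ps ((b + 1) * a + h *: b) * cst_ps b : ps H) n * (b + 1) :> H.
Proof. by rewrite -(partial_coef_b h a b n); exact: der_b. Qed.

Let z n : H := a * b ^+ n.

Let ddE n (w : H) :
  dd h n w = ((- h) ^+ n.-1 / n%:R) *: ((sh h (z n) w : H) - z n * w) :> H.
Proof. reflexivity. Qed.

Let sh_z_b n : sh h (z n) b = b * z n :> H.
Proof.
rewrite -[X in sh h _ X](mulr1 b).
have -> := @sh_br C h (z n) 1; by rewrite shw1.
Qed.

(** The rule for two leading a's, with a read as a 1; shuffling with b^n is left multiplication by
    b^n. *)
Let sh_z_a n : sh h (z n) a = a * (z n + b ^+ n * a + h *: b ^+ n) :> H.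
Proof.
have := @sh_aa C h (b ^+ n) 1; rewrite (mulr1 a) (shw1 h (a * _)).
by rewrite !(@sh_bX C h n) mulr1.
Qed.

Let dd_b n : dd h n b =
  b * (cst_ps a * log_ps (h *: b) * cst_ps b : ps H) n
  - (cst_ps a * log_ps (h *: b) * cst_ps b : ps H) n * b :> H.
Proof.
rewrite (log_b_coef h a b n) ddE sh_z_b -scalerAr -scalerAl -scalerBr.
reflexivity.
Qed.

Let dd_a n : dd h n a =
  (a + h *: 1) * (cst_ps a * log_ps (h *: b) * cst_ps b : ps H) n :> H.
Proof.
rewrite (log_b_coef h a b n) ddE sh_z_a -scalerAr; congr (_ *: _).
exact: dd_coef_a.
Qed.

Let comp_a : @opexp_comp C free_alg (@delta C) (dd h) (partial h) a.
Proof.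
exact: (@opexp_comp_a C free_alg natU h a b _ _ _ l_delta l_dd d_dd
  l_partial d_partial delta_a dd_a dd_b partial_a partial_b).
Qed.

Let comp_b : @opexp_comp C free_alg (@delta C) (dd h) (partial h) b.
Proof.
exact: (@opexp_comp_b C free_alg natU h a b _ _ _ l_delta d_delta l_dd d_dd
  l_partial d_partial delta_a delta_b dd_a dd_b partial_a partial_b).
Qed.

Let P : H -> Prop := @opexp_comp C free_alg (@delta C) (dd h) (partial h).

Let P1 : P 1. Proof.
exact: (@opexp_comp1 C free_alg _ _ _ l_delta d_delta l_dd d_dd
  l_partial d_partial).
Qed.

Let PM x y : P x -> P y -> P (x * y). Proof.
exact: (@opexp_compM C free_alg natU _ _ _ l_delta d_delta l_dd d_dd
  l_partial d_partial).
Qed.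

Let P_lin c x y : P x -> P y -> P (c *: x + y).
Proof. exact: (@opexp_comp_lin C free_alg _ _ _ l_delta l_dd l_partial). Qed.

Let P_wd s : P (wd C s).
Proof.
elim: s => [|x s IHs].
  have -> : wd C [::] = 1 :> H by exact: wd_nil.
  exact: P1.
have -> : wd C (x :: s) = (wd C [:: x] : H) * wd C s by exact: wd_cons.
by apply: PM IHs; case: x; [exact: comp_a | exact: comp_b].
Qed.

Lemma exp_comparison (w : H) : Phi w = Psi h (Delta h w).
Proof. by rewrite PhiE Psi_DeltaE; exact: (@Hfr_ind C P P_wd P_lin w). Qed.

End FreeAlgebra.

Theorem theorem3p10 (w : freealg laurent) :
  Phi w =1 Psi hbar (Delta hbar w).
Proof.
have natU n : (n.+1%:R : laurent) \is a GRing.unit.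
  exact: laurent_natr_unit.
by move=> m; rewrite (exp_comparison hbar natU).
Qed.
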